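(* For any zerosumfree semiring $S$, the following are equivalent: (1) $S$ is a right congruence-semisimple semiring; (2) $S \cong M_{n_1}(\mathbb{B}) \times \cdots \times M_{n_k}(\mathbb{B})$, with $\mathbb{B}$ the Boolean semifield and $k, n_1, \dots, n_k$ some positive integers; (3) $S$ is a left congruence-semisimple semiring.
   Context: A semiring $(S,+,\cdot,0,1)$ consists of a commutative monoid $(S,+,0)$ and a monoid $(S,\cdot,1)$ such that multiplication distributes over addition on both sides and $0s=0=s0$ for all $s\in S$. It is zerosumfree if $a+b=0$ implies $a=b=0$. A right $S$-semimodule is a commutative monoid $(M,+,0_M)$ with a scalar multiplication $M\times S\to M$ satisfying $m(ss')=(ms)s'$, $(m+m')s=ms+m's$, $m(s+s')=ms+ms'$, $m1=m$, $0_Ms=0_M=m0$; left semimodules are defined symmetrically. A right (left) ideal of $S$ is a subsemimodule of $S$ regarded as a right (left) semimodule over itself. A congruence on a semimodule is an equivalence relation compatible with addition and scalar multiplication. A nonzero semimodule $M$ is congruence-simple if its only congruences are the identity congruence $\{(m,m)\mid m\in M\}$ and the universal congruence $M\times M$; a right (left) ideal is congruence-simple if it is so as a right (left) $S$-semimodule. A semiring $S$ is right (left) congruence-semisimple if $S$ is a direct sum of congruence-simple right (left) ideals. The Boolean semifield is $\mathbb{B}=(\{0,1\},\max,\min,0,1)$, $M_n(\mathbb{B})$ is the semiring of $n\times n$ matrices over $\mathbb{B}$, and $\cong$ in (2) denotes isomorphism of semirings. *)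

(* Defs.v *)
From HB Require Import structures.
From Stdlib Require Import RelationClasses.
From mathcomp Require Import all_boot all_algebra finmap.

Set Implicit Arguments.
Unset Strict Implicit.
Unset Printing Implicit Defensive.

Import GRing.Theory.
Local Open Scope ring_scope.

Definition zerosumfree (S : pzSemiRingType) : Prop :=
  forall a b : S, a + b = 0 -> a = 0 /\ b = 0.

Definition semiring_iso (R T : pzSemiRingType) : Prop :=
  exists f : {rmorphism R -> T}, bijective f.

(* A fresh name for bool, because MathComp's ring structure on bool itself is
   that of the two-element field (addition is exclusive or). *)
Definition boolB : Type := bool.

HB.instance Definition _ := Finite.copy boolB bool.
HB.instance Definition _ := GRing.isPzSemiRing.Build boolB
  orbA orbC orFb andbA andTb andbT andb_orl andb_orr andFb andbF.

Section ProductSemiring.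

Variables (I : finType) (R : I -> pzSemiRingType).
Local Notation P := {dffun forall i : I, R i}.

Definition prod_zero : P := [ffun i => 0 : R i].
Definition prod_add (f g : P) : P := [ffun i => f i + g i].
Definition prod_one : P := [ffun i => 1 : R i].
Definition prod_mul (f g : P) : P := [ffun i => f i * g i].

Fact prod_addA : associative prod_add.
Proof. by move=> f g h; apply/ffunP=> i; rewrite !ffunE addrA. Qed.
Fact prod_addC : commutative prod_add.
Proof. by move=> f g; apply/ffunP=> i; rewrite !ffunE addrC. Qed.
Fact prod_add0 : left_id prod_zero prod_add.
Proof. by move=> f; apply/ffunP=> i; rewrite !ffunE add0r. Qed.
Fact prod_mulA : associative prod_mul.
Proof. by move=> f g h; apply/ffunP=> i; rewrite !ffunE mulrA. Qed.
Fact prod_mul1l : left_id prod_one prod_mul.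
Proof. by move=> f; apply/ffunP=> i; rewrite !ffunE mul1r. Qed.
Fact prod_mul1r : right_id prod_one prod_mul.
Proof. by move=> f; apply/ffunP=> i; rewrite !ffunE mulr1. Qed.
Fact prod_mulDl : left_distributive prod_mul prod_add.
Proof. by move=> f g h; apply/ffunP=> i; rewrite !ffunE mulrDl. Qed.
Fact prod_mulDr : right_distributive prod_mul prod_add.
Proof. by move=> f g h; apply/ffunP=> i; rewrite !ffunE mulrDr. Qed.
Fact prod_mul0l : left_zero prod_zero prod_mul.
Proof. by move=> f; apply/ffunP=> i; rewrite !ffunE mul0r. Qed.
Fact prod_mul0r : right_zero prod_zero prod_mul.
Proof. by move=> f; apply/ffunP=> i; rewrite !ffunE mulr0. Qed.

HB.instance Definition _ := GRing.isPzSemiRing.Build P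
  prod_addA prod_addC prod_add0 prod_mulA prod_mul1l prod_mul1r
  prod_mulDl prod_mulDr prod_mul0l prod_mul0r.

Definition prod_semiring : pzSemiRingType := P.

End ProductSemiring.

Section Semimodules.

Variable R : pzSemiRingType.

Record congruence (M : lSemiModType R) (r : M -> M -> Prop) : Prop :=
  Congruence {
    congruence_equiv : Equivalence r;
    congruenceD : forall x x' y y', r x x' -> r y y' -> r (x + y) (x' + y');
    congruenceZ : forall (a : R) x x', r x x' -> r (a *: x) (a *: x')
  }.

Definition congruence_simple (M : lSemiModType R) : Prop :=
  (exists x : M, x != 0) /\
  forall r : M -> M -> Prop, congruence r ->
    (forall x y, r x y <-> x = y) \/ (forall x y, r x y).

Section Subsemimodule.

Variables (M : lSemiModType R) (N : submodClosed M).

Definition subsemimod : Type := {x : M | x \in N}.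

HB.instance Definition _ := SubChoice.on subsemimod.
HB.instance Definition _ := [SubChoice_isSubLSemiModule of subsemimod by <:].

End Subsemimodule.

(* The internal direct sum: the addition map from the external direct sum of
   the N j (families with finite support) to M is a bijection. *)
Definition direct_sum (M : lSemiModType R) (J : choiceType)
    (N : J -> submodClosed M) : Prop :=
  forall x : M, exists! f : {fsfun J -> M with 0},
    (forall j, f j \in N j) /\ x = \sum_(j <- finsupp f) f j.

(* The index type is required to be nonempty, so that the zero semimodule is
   not counted as an (empty) direct sum of congruence-simple ones. *)
Definition congruence_semisimple (M : lSemiModType R) : Prop :=
  exists (J : choiceType) (N : J -> submodClosed M),
    [/\ inhabited J, forall j, congruence_simple (subsemimod (N j))
      & direct_sum N].

End Semimodules.

Definition left_congruence_semisimple (S : pzSemiRingType) : Prop :=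
  congruence_semisimple (S^o : lSemiModType S).

(* Right S-semimodules are the left semimodules over the converse semiring
   S^c; in (S^c)^o the scalar action is a *: x = x * a (product in S), so that
   submodClosed (S^c)^o is the type of right ideals of S. *)
Definition right_congruence_semisimple (S : pzSemiRingType) : Prop :=
  congruence_semisimple ((S^c)^o : lSemiModType S^c).

(* Main.v *)
(* Let S be zerosumfree and S = (+)_i S e_i with the S e_i congruence-simple and
   the e_i orthogonal idempotents of sum 1.  Two kinds of congruences on S e_j
   do all the work: the kernel of a right multiplication S e_j -> S e_k, and,
   for a fixed t, the relation "t s x = 0 iff t s y = 0 for all s".
   By the first, nonzero maps between the S e_j are injective; hence all nonzero
   elements of e_i S e_j have the annihilator of e_i, so by the second (t = 1)
   there is at most one of them.  The second with t = e_j shows that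
   e_i S e_j <> 0 implies e_j S e_i <> 0.  So "e_i S e_j <> 0" is an equivalence
   relation, and recording which corners e_i x e_j are nonzero identifies S with
   a product of Boolean matrix semirings, one for each class.
   These properties of the e_i are left-right symmetric, and conversely they
   imply that the S e_i are congruence-simple,
   whence both sides at once. *)
Require Import Defs.
From mathcomp Require Import all_boot all_algebra.
From HB Require Import structures.
From mathcomp Require Import finmap boolp.

Set Implicit Arguments.
Unset Strict Implicit.
Unset Printing Implicit Defensive.

Import GRing.Theory.
Local Open Scope ring_scope.

(** * Complete families of orthogonal idempotents with Boolean corners *)

(** Abstracts the diagonal matrix units of a product of Boolean matrix semirings: a corner has at
    most one nonzero element, and being nonzero is a symmetric, transitive relation on indices. *)
Record peirce_boolean (S : pzSemiRingType) (I : finType) (e : I -> S) : Prop :=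
  PeirceBoolean {
    peirce_sum : \sum_i e i = 1;
    peirce_mul : forall i j, e i * e j = if i == j then e i else 0;
    peirce_neq0 : forall i, e i != 0;
    peirce_uniq : forall i j x y, e i * x * e j != 0 -> e i * y * e j != 0 ->
      e i * x * e j = e i * y * e j;
    peirce_mul_neq0 : forall i j k x y,
      e i * x * e j != 0 -> e j * y * e k != 0 ->
      e i * x * e j * y * e k != 0;
    peirce_sym : forall i j x, e i * x * e j != 0 ->
      exists y, e j * y * e i != 0
  }.

Definition has_peirce (S : pzSemiRingType) : Prop :=
  exists (I : finType) (e : I -> S), inhabited I /\ peirce_boolean e.

Lemma mul_converse (S : pzSemiRingType) (a b : S) :
  @GRing.mul S^c a b = @GRing.mul S b a.
Proof. by []. Qed.

(** Reversing products only exchanges the two indices of a corner, so the same [e] serves on both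
    sides. *)
Lemma has_peirce_converse (S : pzSemiRingType) :
  has_peirce S <-> has_peirce S^c.
Proof.
split=> -[I [e [hI [e1 eM e0 eu eM0 esym]]]]; exists I, e; split=> //;
  split=> //.
- by move=> i j; rewrite mul_converse eM eq_sym; case: eqP => [->|].
- by move=> i j x y; rewrite !mul_converse !mulrA; apply: eu.
- move=> i j k x y; rewrite !mul_converse !mulrA => h1 h2.
  by have := eM0 _ _ _ _ _ h2 h1.
- move=> i j x; rewrite !mul_converse mulrA => /esym[y hy].
  by exists y; rewrite !mul_converse mulrA.
- by move=> i j; rewrite -mul_converse eM eq_sym; case: eqP => [->|].
- move=> i j x y; have := eu j i x y.
  by rewrite !mul_converse !mulrA.
- move=> i j k x y h1 h2; have := eM0 k j i y x.
  by rewrite !mul_converse !mulrA; apply; rewrite -?mulrA // !mulrA.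
- move=> i j x; have := esym j i x; rewrite !mul_converse mulrA => h /h[y].
  by rewrite !mul_converse mulrA => hy; exists y.
Qed.

(** * Uniqueness of components and restriction of congruences *)

Section DirectSum.
Variables (R : pzSemiRingType) (M : lSemiModType R) (J : choiceType).

Lemma sum_fsfun (K : {fset J}) (h : J -> M) (f := [fsfun j in K => h j | 0]) :
  \sum_(j <- finsupp f) f j = \sum_(j <- K) h j.
Proof.
have fK : (finsupp f `<=` K)%fset by apply: finsupp_sub.
rewrite (big_fset_incl _ fK) => [|j _]; last by rewrite memNfinsupp => /eqP.
by apply: eq_big_seq => j jK; rewrite /f fsfun_fun jK.
Qed.

Lemma direct_sum_inj (N : J -> submodClosed M) (f g : {fsfun J -> M with 0}) :
    direct_sum N -> (forall j, f j \in N j) -> (forall j, g j \in N j) ->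
  \sum_(j <- finsupp f) f j = \sum_(j <- finsupp g) g j -> f =1 g.
Proof.
move=> dsN fN gN fg j; have [h [_ hu]] := dsN (\sum_(j <- finsupp f) f j).
by rewrite -(hu f) // -(hu g).
Qed.

End DirectSum.

(** Lets a congruence be given by a formula on all of [M]: its restriction to [N] is a congruence of
    [N], hence trivial. *)
Lemma congruence_simple_sub (R : pzSemiRingType) (M : lSemiModType R)
    (N : submodClosed M) (r : M -> M -> Prop) :
    congruence_simple (subsemimod N) -> congruence r ->
  {in N &, forall x y, r x y -> x = y} \/ {in N &, forall x y, r x y}.
Proof.
move=> [_ Ns] [[rr rs rt] rD rZ].
have /Ns : congruence (fun x y : subsemimod N => r (val x) (val y)).
  split.
  - by split=> [x|x y|x y z]; [apply: rr|apply: rs|apply: rt].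
  - by move=> x x' y y'; apply: rD.
  - by move=> a x x'; apply: rZ.
case=> h; [left|right] => x y xN yN.
  by move/(h (exist _ x xN) (exist _ y yN)) => /(congr1 val).
exact: (h (exist _ x xN) (exist _ y yN)).
Qed.

(** * From simple left ideals to idempotents *)

Section SemisimpleToPeirce.
Variables (S : pzSemiRingType) (S_zsf : zerosumfree S).

Lemma congruence_mulr (a : S) :
  congruence (fun x y : S^o => (x : S) * a = y * a).
Proof.
split; first by split=> [x|x y|x y z] //; apply: etrans.
- by move=> x x' y y' /= xx' yy'; rewrite !mulrDl xx' yy'.
- by move=> b x x' xx'; have /= := congr1 ( *%R b) xx'; rewrite !mulrA.
Qed.

(** Zerosumfreeness gives compatibility with sums: [t * s * (x + y)] vanishes only if both terms do.
    Letting [s] range over [S] absorbs scalars. *)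
Lemma congruence_annihilator (t : S) :
  congruence (fun x y : S^o => forall s : S, t * s * x = 0 <-> t * s * y = 0).
Proof.
have add0 (x y : S) : x + y = 0 <-> x = 0 /\ y = 0.
  by split=> [/S_zsf|[-> ->]]; rewrite ?addr0.
split.
- by split=> [x|x y h s|x y z h k s] //; rewrite h ?k.
- by move=> x x' y y' xx' yy' s; rewrite !mulrDr !add0 xx' yy'.
- by move=> b x x' xx' s; have := xx' (s * b); rewrite !mulrA.
Qed.

Variables (J : choiceType) (N : J -> submodClosed (S^o : lSemiModType S)).
Hypothesis N_simple : forall j, congruence_simple (subsemimod (N j)).
Hypothesis N_sum : direct_sum N.
(** [u] is the family of components of 1 and [K] its support. *)
Variables (K : {fset J}) (u : J -> S).
Hypothesis uN : forall j, u j \in N j.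
Hypothesis u_neq0 : forall j, (u j != 0) = (j \in K).
Hypothesis sum_u : \sum_(j <- K) u j = 1.

(** The family [x * u k] and the family with [x] alone in position [j] both decompose [x], so they
    agree. For [x = u j] this makes the [u j] orthogonal idempotents. *)
Lemma mul_component j (x : S) k :
  x \in N j -> x * u k = if k == j then x else 0.
Proof.
move=> xN; pose f := [fsfun k in K => (x * u k : S^o) | 0].
pose g := [fsfun k in [fset j]%fset => (x : S^o) | 0].
have fE i : f i = x * u i.
  by rewrite fsfun_fun -u_neq0; case: eqP => //= ->; rewrite mulr0.
have gE i : g i = if i == j then x else 0 by rewrite fsfun_fun inE.
rewrite -fE -gE; apply: (direct_sum_inj N_sum) => [i|i|].
- by rewrite fE; apply: (rpredZ x).
- by rewrite gE; case: eqP => [->|_] //; apply: rpred0.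
- rewrite !sum_fsfun big_seq_fset1.
  by rewrite -mulr_sumr sum_u mulr1.
Qed.

Lemma mem_component j (x : S) : x * u j \in N j.
Proof. by apply: (rpredZ x). Qed.

(** The kernel of right multiplication by [x * u j] separates [u i] from 0, so it is the identity on
    [N i]; but [y * u i] and 0 have the same image. *)
Lemma mulIr_component i j (x y : S) :
  u i * x * u j != 0 -> y * u i * x * u j = 0 -> y * u i = 0.
Proof.
move=> /eqP nz yx0.
have [inj|univ] :=
  congruence_simple_sub (N_simple i) (congruence_mulr (x * u j)).
- by apply: inj (mem_component i y) (rpred0 _) _; rewrite /= mul0r !mulrA.
- by case: nz; have /= := univ _ _ (uN i) (rpred0 (N i)); rewrite mul0r mulrA.
Qed.

(** At [s = 1] the annihilator congruence separates [u j] from 0, so it is the identity on [N j]. *)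
Lemma annihilator_inj j (t x y : S) :
    t * u j != 0 -> x \in N j -> y \in N j ->
  (forall s, t * s * x = 0 <-> t * s * y = 0) -> x = y.
Proof.
move=> /eqP nz xN yN xy.
have [inj|univ] :=
  congruence_simple_sub (N_simple j) (congruence_annihilator t).
- exact: inj xN yN xy.
- case: nz; have /= := univ _ _ (uN j) (rpred0 (N j)) 1.
  by rewrite !mulr1 mulr0 => ->.
Qed.

Lemma peirce_component :
  peirce_boolean (fun i : K => u (val i)).
Proof.
have u0 (i : K) : u (val i) != 0 by rewrite u_neq0; apply: valP.
split=> //.
- by rewrite -sum_u big_seq_fsetE.
- by move=> i j; rewrite (mul_component _ (uN _)) val_eqE eq_sym.
- move=> i j x y x0 y0.
  apply: (annihilator_inj (t := 1) _ (mem_component _ _) (mem_component _ _)).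
    by rewrite mul1r.
  (* Every nonzero element of the corner has the left annihilator of [u (val i)], so any two are
     congruent for [t = 1]. *)
  have anni z s : u (val i) * z * u (val j) != 0 ->
      s * (u (val i) * z * u (val j)) = 0 <-> s * u (val i) = 0.
    move=> z0; split; last by rewrite !mulrA => ->; rewrite !mul0r.
    by rewrite !mulrA; apply: mulIr_component.
  by move=> s; rewrite mul1r !anni.
- move=> i j k x y x0 y0; apply: contra_neq x0 => xy0.
  by apply: mulIr_component y0 _.
- move=> i j x x0; apply: contrapT => no.
  case/eqP: x0.
  (* If the opposite corner is zero, then [u (val j) * s * u (val i)] is always 0, so the corner
     element is congruent to 0. *)
  apply: (annihilator_inj (t := u (val j)) _ (mem_component _ _) (rpred0 _)).
    by rewrite (mul_component _ (uN _)) eqxx u0.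
  move=> s; rewrite mulr0; split=> // _; rewrite !mulrA.
  have [->|sn0] := eqVneq (u (val j) * s * u (val i)) 0.
    by rewrite !mul0r.
  by case: no; exists s.
Qed.

End SemisimpleToPeirce.

Lemma has_peirce_semisimple (S : pzSemiRingType) :
  zerosumfree S -> left_congruence_semisimple S -> has_peirce S.
Proof.
move=> S_zsf [J [N [[j] Ns Nsum]]].
have [u [[uN u1] _]] := Nsum 1.
have u_neq0 j' : (u j' != 0) = (j' \in finsupp u) by rewrite mem_finsupp.
exists (finsupp u), (fun i => u (val i)).
split; last exact: (peirce_component S_zsf Ns Nsum uN u_neq0 (esym u1)).
have [[[x xN] x0] _] := Ns j.
(* The index set is nonempty: [x * u j = x] with [x] nonzero forces [u j] to be nonzero. *)
suff ju : j \in finsupp u by exists; exists j.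
rewrite -u_neq0; apply: contra_neq x0 => uj0; apply: val_inj => /=.
by have := mul_component Nsum uN u_neq0 (esym u1) j xN; rewrite eqxx uj0 mulr0.
Qed.

(** * From idempotents back to simple left ideals *)

(** For idempotent [a] this is the left ideal generated by [a], with membership decided by an
    equation. *)
Definition fixed_by (S : pzSemiRingType) (a : S) : {pred S^o} :=
  fun x => (x : S) * a == x.

Section FixedBy.
Variables (S : pzSemiRingType) (a : S).

Fact fixed_by_addr_closed : GRing.addr_closed (fixed_by a).
Proof.
split=> [|x y]; rewrite !unfold_in ?mul0r //.
by move=> /eqP xa /eqP ya; rewrite mulrDl xa ya.
Qed.

Fact fixed_by_scaler_closed : GRing.scaler_closed (fixed_by a).
Proof.
move=> b x; rewrite !unfold_in => /eqP xa.
by rewrite -[b *: x]/(b * x) -mulrA xa.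
Qed.

HB.instance Definition _ :=
  GRing.isAddClosed.Build S^o (fixed_by a) fixed_by_addr_closed.
HB.instance Definition _ :=
  GRing.isScaleClosed.Build S S^o (fixed_by a) fixed_by_scaler_closed.

End FixedBy.

Definition left_ideal_fixed (S : pzSemiRingType) (a : S) :
  submodClosed (S^o : lSemiModType S) := fixed_by a.

Lemma mem_left_ideal_fixed (S : pzSemiRingType) (a x : S) :
  ((x : S^o) \in left_ideal_fixed a) = (x * a == x).
Proof. by []. Qed.

Section PeirceToSemisimple.
Variables (S : pzSemiRingType) (I : finType) (e : I -> S).
Hypothesis e_peirce : peirce_boolean e.

Let e1 := peirce_sum e_peirce.
Let eM := peirce_mul e_peirce.

Lemma idem_peirce i : e i * e i = e i.
Proof. by rewrite eM eqxx. Qed.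

(** Take [s = e i * z * e k] nonzero, by symmetry. It kills [x], while [s * y] is nonzero in the
    corner at [(i, i)], whose only nonzero element is [e i]. *)
Lemma component_separation i k (x y : S) :
    x * e i = x -> y * e i = y -> e k * x = 0 -> e k * y != 0 ->
  exists s, s * x = 0 /\ s * y = e i.
Proof.
move=> xi yi kx0; rewrite -yi mulrA => ky0.
have [z z0] := peirce_sym e_peirce ky0.
exists (e i * z * e k); split; first by rewrite -mulrA kx0 mulr0.
have zy0 := peirce_mul_neq0 e_peirce z0 ky0.
have ii0 : e i * 1 * e i != 0.
  by rewrite mulr1 idem_peirce (peirce_neq0 e_peirce).
have H := @peirce_uniq _ _ _ e_peirce i i (z * e k * y) 1.
rewrite mulr1 idem_peirce !mulrA in ii0 H.
by rewrite mulrA (H zy0 ii0).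
Qed.

(** Since the [e k] sum to 1, some [e k * x] and [e k * y] differ; nonzero elements of one corner
    coincide, so exactly one of these two is 0. *)
Lemma component_neq i (x y : S) : x * e i = x -> y * e i = y -> x <> y ->
  exists s, (s * x = 0 /\ s * y = e i) \/ (s * x = e i /\ s * y = 0).
Proof.
move=> xi yi xy; have /forallPn[k kxy] : ~~ [forall k, e k * x == e k * y].
  apply/negP=> /forallP h; apply: xy.
  rewrite -[x]mul1r -[y]mul1r -e1 !mulr_suml.
  by apply: eq_bigr => k _; apply/eqP.
have [kx0|kx0] := eqVneq (e k * x) 0.
  have [|s s_xy] := component_separation xi yi kx0; last by exists s; left.
  by rewrite kx0 eq_sym in kxy.
have [ky0|ky0] := eqVneq (e k * y) 0.
  have [s [sy sx]] := component_separation yi xi ky0 kx0.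
  by exists s; right.
case/eqP: kxy; rewrite -xi -yi !mulrA.
by apply: (peirce_uniq e_peirce); rewrite -mulrA ?xi ?yi.
Qed.

(** A congruence relating two distinct elements relates, after scaling by a separating [s], 0 to
    [e i]; as [e i] generates the ideal, everything is then related to 0. *)
Lemma component_simple i :
  congruence_simple (subsemimod (left_ideal_fixed (e i))).
Proof.
split.
  have ei : (e i : S^o) \in left_ideal_fixed (e i).
    by rewrite mem_left_ideal_fixed idem_peirce eqxx.
  by exists (exist _ (e i : S^o) ei); apply: (peirce_neq0 e_peirce).
move=> r [[rr rs rt] rD rZ].
have [rid|[x [y [rxy xy]]]] : (forall x y, r x y -> x = y) \/
    exists x y, r x y /\ x <> y.
  have [h|h] := pselect (forall x y, r x y -> x = y); first by left.
  right; apply: contrapT => no; apply: h => x y rxy; apply: contrapT => xy.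
  by apply: no; exists x, y.
- by left=> x y; split=> [/rid|->].
have inN (z : subsemimod (left_ideal_fixed (e i))) : (val z : S) * e i = val z.
  by apply/eqP; rewrite -mem_left_ideal_fixed; apply: valP.
have [|s s_xy] := component_neq (inN x) (inN y); first by move/val_inj.
have eiN : (e i : S^o) \in left_ideal_fixed (e i).
  by rewrite mem_left_ideal_fixed idem_peirce eqxx.
pose u : subsemimod (left_ideal_fixed (e i)) := exist _ (e i : S^o) eiN.
have ZE (z w : subsemimod (left_ideal_fixed (e i))) :
    s * val z = val w :> S -> s *: z = w.
  by move=> szw; apply: val_inj; rewrite GRing.valZ; apply: szw.
have r0u : r 0 u.
  have := rZ s _ _ rxy; case: s_xy => -[sx sy].
    have -> : s *: x = 0 by apply: ZE.
    by have -> : s *: y = u by apply: ZE.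
  have -> : s *: x = u by apply: ZE.
  have -> : s *: y = 0 by apply: ZE.
  exact: rs.
have r0 z : r 0 z.
  have := rZ (val z : S) _ _ r0u; rewrite scaler0.
  suff -> : (val z : S) *: u = z by [].
  by apply: val_inj; rewrite GRing.valZ; apply: inN.
by right=> z w; apply: rt (r0 w); apply: rs.
Qed.

(** The component of [x] at [i] must be [x * e i]: right multiplication by [e i] kills all other
    terms. *)
Lemma peirce_direct_sum : direct_sum (fun i => left_ideal_fixed (e i)).
Proof.
have sum_finsupp (g : {fsfun I -> S^o with 0}) :
    \sum_(i <- finsupp g) g i = \sum_i (g i : S).
  rewrite big_uniq ?fset_uniq //; apply: big_rmcond => i.
  by rewrite memNfinsupp => /eqP.
move=> x; pose K := [fset i in enum I]%fset.
pose f : {fsfun I -> S^o with 0} := [fsfun i in K => ((x : S) * e i : S^o) | 0].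
have fE i : f i = (x : S) * e i by rewrite fsfun_fun in_fset /= mem_enum.
exists f; split=> [|g [gN xg]]; first split=> [i|].
- by rewrite fE mem_left_ideal_fixed -mulrA idem_peirce.
- rewrite sum_finsupp -[LHS](mulr1 (x : S)) -e1 mulr_sumr.
  by apply: eq_bigr => i _; rewrite fE.
have ge i : (g i : S) * e i = g i.
  by apply/eqP; rewrite -mem_left_ideal_fixed; apply: gN.
apply/fsfunP=> i; rewrite fE xg sum_finsupp mulr_suml.
rewrite (bigD1 i) //= ge big1 ?addr0 // => j ji.
by rewrite -ge -mulrA eM (negPf ji) mulr0.
Qed.

End PeirceToSemisimple.

Lemma has_peirce_left_semisimple (S : pzSemiRingType) :
  has_peirce S -> left_congruence_semisimple S.
Proof.
case=> I [e [hI he]]; exists I, (fun i => left_ideal_fixed (e i)); split=> //.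
- exact: component_simple.
- exact: peirce_direct_sum.
Qed.

(** * Isomorphisms, coordinates of products, and zerosumfree sums *)

Section SemiringIso.
Variables (R T : pzSemiRingType) (f : R -> T).
Hypotheses (f_nmod : nmod_morphism f) (f_monoid : monoid_morphism f).

HB.instance Definition _ := GRing.isNmodMorphism.Build R T f f_nmod.
HB.instance Definition _ := GRing.isMonoidMorphism.Build R T f f_monoid.

Lemma semiring_iso_morphism :
  injective f -> (forall y, exists x, f x = y) -> semiring_iso R T.
Proof.
move=> f_inj f_surj; have f_surjb y : exists x, f x == y.
  by have [x <-] := f_surj y; exists x.
exists f; exists (fun y => xchoose (f_surjb y)) => [x|y].
- by apply: f_inj; apply/eqP/(xchooseP (f_surjb (f x))).
- by apply/eqP/(xchooseP (f_surjb y)).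
Qed.

End SemiringIso.

(** Turns an entry of a matrix product over [boolB] into a search for a middle index. *)
Lemma boolB_sum (I : finType) (F : I -> boolB) :
  \sum_i F i = [exists i, F i] :> boolB.
Proof. exact: (big_orE xpredT F). Qed.

Section Coordinates.
Variables (I : finType) (R : I -> pzSemiRingType).
Implicit Types x y : prod_semiring R.

Definition coord x (i : I) : R i := (x : {dffun forall i : I, R i}) i.

Lemma coord_inj x y : (forall i, coord x i = coord y i) -> x = y.
Proof. by move=> xy; apply/ffunP. Qed.

Lemma coord0 i : coord 0 i = 0. Proof. exact: ffunE. Qed.
Lemma coord1 i : coord 1 i = 1. Proof. exact: ffunE. Qed.
Lemma coordD x y i : coord (x + y) i = coord x i + coord y i.
Proof. exact: ffunE. Qed.
Lemma coordM x y i : coord (x * y) i = coord x i * coord y i.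
Proof. exact: ffunE. Qed.

End Coordinates.

Section ZeroSumFree.
Variables (S : pzSemiRingType) (S_zsf : zerosumfree S).

Lemma zsf_add_eq0 (x y : S) : (x + y == 0) = (x == 0) && (y == 0).
Proof.
by apply/eqP/andP=> [/S_zsf[-> ->]|[/eqP-> /eqP->]]; rewrite ?addr0.
Qed.

(** Counterpart in [S] of [boolB_sum]: testing for nonzero turns sums into disjunctions. *)
Lemma zsf_sum_neq0 (J : finType) (F : J -> S) :
  (\sum_j F j != 0) = [exists j, F j != 0].
Proof.
apply/idP/existsP => [|[j Fj]].
  apply: contra_neqP => noF; rewrite big1 // => j _.
  by apply/eqP/negP=> Fj; apply: noF; exists j; apply/negP.
by rewrite (bigD1 j) //= zsf_add_eq0 negb_and Fj.
Qed.

End ZeroSumFree.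

(** * The isomorphism onto a product of Boolean matrix semirings *)

Section PeirceToMatrices.
Variables (S : pzSemiRingType) (I : finType) (e : I -> S).
Hypotheses (S_zsf : zerosumfree S) (e_peirce : peirce_boolean e).

Let e1 := peirce_sum e_peirce.
Let eM := peirce_mul e_peirce.

Definition linked (i j : I) : bool := `[< exists x, e i * x * e j != 0 >].

Lemma linkedP i j : reflect (exists x, e i * x * e j != 0) (linked i j).
Proof. exact: asboolP. Qed.

Lemma linked_mul i j x : e i * x * e j != 0 -> linked i j.
Proof. by move=> ijx; apply/linkedP; exists x. Qed.

Lemma linked_equiv : {in [set: I] & &, equivalence_rel linked}.
Proof.
have sym i j : linked i j -> linked j i.
  by move/linkedP=> [x /(peirce_sym e_peirce)/linkedP].
have trans i j k : linked i j -> linked j k -> linked i k.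
  move/linkedP=> [x hx] /linkedP[y hy].
  have := peirce_mul_neq0 e_peirce hx hy.
  by rewrite -(mulrA (e i) x) -(mulrA (e i) (x * _)) => /linked_mul.
move=> i j k _ _ _; split.
  by apply/linkedP; exists 1; rewrite mulr1 eM eqxx (peirce_neq0 e_peirce).
by move=> ij; apply/idP/idP; apply: trans; [apply: sym|].
Qed.

Definition blocks := equivalence_partition linked [set: I].

(** Classes are numbered by ordinals to index the factors, and likewise the members of a class to
    index rows and columns. *)
Definition block (c : 'I_#|blocks|) : {set I} := enum_val c.

Definition entry (c : 'I_#|blocks|) (p : 'I_#|block c|) : I := enum_val p.

Lemma block_linked c i j : i \in block c -> (j \in block c) = linked i j.
Proof.
move=> ic; have /and3P[_ tiP _] := equivalence_partitionP linked_equiv.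
rewrite -(pblock_equivalence_partition linked_equiv) ?inE //.
by rewrite (def_pblock tiP (enum_valP c) ic).
Qed.

Lemma entry_linked c (p q : 'I_#|block c|) : linked (entry p) (entry q).
Proof. by rewrite -(block_linked _ (enum_valP p)) enum_valP. Qed.

Lemma entry_surj i : exists (c : 'I_#|blocks|) (p : 'I_#|block c|), entry p = i.
Proof.
have /and3P[/eqP covP _ _] := equivalence_partitionP linked_equiv.
have /bigcupP[B PB iB] : i \in cover blocks by rewrite covP inE.
have Bc : block (enum_rank_in PB B) = B by rewrite /block enum_rankK_in.
rewrite -Bc in iB; exists (enum_rank_in PB B), (enum_rank_in iB i).
by rewrite /entry enum_rankK_in.
Qed.

Lemma entry_block c d (p : 'I_#|block c|) (q : 'I_#|block d|) :
  linked (entry p) (entry q) -> c = d.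
Proof.
rewrite -(block_linked _ (enum_valP p)) => qc.
have /and3P[_ tiP _] := equivalence_partitionP linked_equiv.
apply: enum_val_inj; rewrite -[LHS](def_pblock tiP (enum_valP c) qc).
exact: (def_pblock tiP (enum_valP d) (enum_valP q)).
Qed.

Definition block_matrices : pzSemiRingType :=
  prod_semiring (fun c : 'I_#|blocks| => 'M[boolB]_#|block c|).

(** No information is lost: a corner has at most one nonzero element, and corners between different
    classes are zero. *)
Definition to_matrices (x : S) : block_matrices :=
  [ffun c => \matrix_(p, q) (e (entry p) * x * e (entry q) != 0 : boolB)].

Lemma to_matricesE x c p q :
  coord (to_matrices x) c p q = (e (entry p) * x * e (entry q) != 0).
Proof. by rewrite /coord ffunE mxE. Qed.

Lemma to_matrices_nmod : nmod_morphism to_matrices.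
Proof.
split=> [|x y]; apply: coord_inj => c; apply/matrixP=> p q.
  by rewrite to_matricesE mulr0 mul0r eqxx coord0 mxE.
by rewrite coordD mxE !to_matricesE mulrDr mulrDl zsf_add_eq0 // negb_and.
Qed.

Lemma to_matrices_monoid : monoid_morphism to_matrices.
Proof.
split=> [|x y]; apply: coord_inj => c; apply/matrixP=> p q.
  rewrite to_matricesE mulr1 eM coord1 mxE.
  case: (eqVneq p q) => [->|pq]; first by rewrite eqxx (peirce_neq0 e_peirce).
  by rewrite (inj_eq enum_val_inj) (negPf pq) eqxx.
rewrite to_matricesE coordM mxE boolB_sum.
(* Inserting the sum of all [e k] between [x] and [y] mirrors the matrix product. *)
have -> : e (entry p) * (x * y) * e (entry q) =
    \sum_k e (entry p) * x * e k * y * e (entry q).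
  rewrite -{1}[x]mulr1 -e1 !mulr_sumr !mulr_suml mulr_sumr mulr_suml.
  by apply: eq_bigr => k _; rewrite !mulrA.
rewrite zsf_sum_neq0 //; apply/existsP/existsP => [[k nz]|[r]].
  have xk : e (entry p) * x * e k != 0.
    by apply: contra_neq nz => ->; rewrite !mul0r.
  have yk : e k * y * e (entry q) != 0.
    by apply: contra_neq nz; rewrite -!mulrA => ->; rewrite !mulr0.
  (* A nonzero term forces its middle index into the class of [entry p]. *)
  have kc : k \in block c.
    by rewrite (block_linked _ (enum_valP p)) (linked_mul xk).
  exists (enum_rank_in kc k); rewrite !to_matricesE /entry enum_rankK_in //.
  by apply/andP.
rewrite !to_matricesE => /andP[xr yr]; exists (entry r).
exact: (peirce_mul_neq0 e_peirce).
Qed.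

Lemma peirce_decomposition x : x = \sum_i \sum_j e i * x * e j.
Proof.
rewrite -[LHS]mul1r -[LHS]mulr1 -e1 -mulrA mulr_suml; apply: eq_bigr => i _.
by rewrite !mulr_sumr; apply: eq_bigr => j _; rewrite mulrA.
Qed.

Lemma to_matrices_inj : injective to_matrices.
Proof.
move=> x y xy; rewrite [x]peirce_decomposition [y]peirce_decomposition.
apply: eq_bigr => i _; apply: eq_bigr => j _.
have nz : (e i * x * e j != 0) = (e i * y * e j != 0).
  have [ij|nij] := boolP (linked i j); last first.
    have zero z : e i * z * e j != 0 = false.
      by apply: contraNF nij => /linked_mul.
    by rewrite !zero.
  have [c [p pi]] := entry_surj i; have [d [q qj]] := entry_surj j.
  rewrite -pi -qj in ij *; have cd := entry_block ij.
  by case: d / cd q {qj ij} => q; rewrite -!to_matricesE xy.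
have [y0|y0] := eqVneq (e i * y * e j) 0.
  by rewrite y0 eqxx in nz *; apply/eqP; rewrite -[_ == _]negbK nz.
by apply: (peirce_uniq e_peirce) => //; rewrite nz.
Qed.

(** Supplies the matrix unit at [(i, j)]: the nonzero element of the corner if there is one. *)
Lemma peirce_unit_exists i j :
  exists a, e i * a * e j = a /\ (linked i j -> a != 0).
Proof.
have [/linkedP[x ij]|nij] := boolP (linked i j); last first.
  by exists 0; rewrite mulr0 mul0r.
exists (e i * x * e j).
by rewrite -!mulrA (idem_peirce e_peirce) !mulrA (idem_peirce e_peirce).
Qed.

Lemma to_matrices_surj (m : block_matrices) : exists x, to_matrices x = m.
Proof.
have [a' a'P] := choice (fun ij => peirce_unit_exists ij.1 ij.2).
pose a i j := a' (i, j).
have aP i j : e i * a i j * e j = a i j /\ (linked i j -> a i j != 0).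
  exact: a'P (i, j).
(* [b] extends [m] to all of [I], false between classes; quantifying over positions avoids locating
   [i] and [j] in their classes. *)
pose b i j := [exists c, exists p : 'I_#|block c|, exists q : 'I_#|block c|,
  [&& entry p == i, entry q == j & coord m c p q]].
exists (\sum_i \sum_j (if b i j then a i j else 0)).
apply: coord_inj => c; apply/matrixP=> p q; rewrite to_matricesE.
set x := \sum_i _.
have -> : e (entry p) * x * e (entry q) =
    if b (entry p) (entry q) then a (entry p) (entry q) else 0.
  have aE k l : e k * (if b k l then a k l else 0) * e l =
                if b k l then a k l else 0.
    by case: (b k l); [have [] := aP k l|rewrite mulr0 mul0r].
  rewrite /x mulr_sumr mulr_suml (bigD1 (entry p)) //=.
  rewrite [X in _ + X]big1 ?addr0 => [|k kp].
    rewrite mulr_sumr mulr_suml (bigD1 (entry q)) //=.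
    rewrite [X in _ + X]big1 ?addr0 ?aE // => l lq.
    by rewrite -aE -!mulrA eM (negPf lq) !mulr0.
  rewrite mulr_sumr mulr_suml big1 // => l _.
  by rewrite -aE !mulrA eM eq_sym (negPf kp) !mul0r.
have -> : b (entry p) (entry q) = coord m c p q.
  apply/existsP/idP => [[d /existsP[p' /existsP[q']]]|mpq].
    move=> /and3P[/eqP pp /eqP qq mpq].
    (* Linked indices share a class, and the numbering of that class is injective, so the witnesses
       are [p] and [q] themselves. *)
    have cd : d = c by apply: (@entry_block _ _ p' p); rewrite pp entry_linked.
    case: c / cd p q pp qq => p q /enum_val_inj pp /enum_val_inj qq in x *.
    by rewrite -pp -qq.
  by exists c; apply/existsP; exists p; apply/existsP; exists q; rewrite !eqxx.
case: (coord m c p q); last by rewrite eqxx.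
by have [_ ->] := aP (entry p) (entry q); rewrite ?entry_linked.
Qed.

Lemma peirce_iso_matrices : inhabited I ->
  exists (k : nat) (n : 'I_k -> nat),
    [/\ (0 < k)%N, forall i : 'I_k, (0 < n i)%N
      & semiring_iso S (prod_semiring (fun i : 'I_k => 'M[boolB]_(n i)))].
Proof.
case=> i; exists #|blocks|, (fun c => #|block c|); split.
- by have [c _] := entry_surj i; apply: leq_ltn_trans (ltn_ord c).
- move=> c; have /and3P[_ _ b0] := equivalence_partitionP linked_equiv.
  by rewrite card_gt0; apply: contraNneq b0 => <-; apply: enum_valP.
- apply: (semiring_iso_morphism to_matrices_nmod to_matrices_monoid).
    exact: to_matrices_inj.
  exact: to_matrices_surj.
Qed.

End PeirceToMatrices.

(** * Diagonal matrix units and transport along isomorphisms *)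

Lemma peirce_iso (S T : pzSemiRingType) (f : {rmorphism S -> T}) (I : finType)
    (e : I -> S) :
  injective f -> peirce_boolean (f \o e) -> (forall y, exists x, f x = y) ->
  peirce_boolean e.
Proof.
move=> f_inj [e1 eM e0 eu eM0 es] f_surj.
have f0 x : (f x == 0) = (x == 0) by rewrite -(rmorph0 f) (inj_eq f_inj).
have fE i x j : f (e i * x * e j) = f (e i) * f x * f (e j) by rewrite !rmorphM.
split=> [|i j|i|i j x y|i j k x y|i j x].
- by apply: f_inj; rewrite rmorph_sum rmorph1.
- by apply: f_inj; rewrite rmorphM [LHS]eM; case: eqP => //; rewrite rmorph0.
- by rewrite -f0; apply: e0.
- by rewrite -!f0 !fE => xn yn; apply: f_inj; rewrite !fE; apply: eu.
- by rewrite -!f0 !rmorphM; apply: eM0.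
- rewrite -f0 fE => /es[y']; have [y <-] := f_surj y'.
  by exists y; rewrite -f0 fE.
Qed.

Section MatricesPeirce.
Variables (k : nat) (n : 'I_k -> nat).
Let T := prod_semiring (fun i : 'I_k => 'M[boolB]_(n i)).
Let index : finType := {i : 'I_k & 'I_(n i)}.
Let tag_index i (p : 'I_(n i)) : index := Tagged (fun i => 'I_(n i)) p.

(** The diagonal matrix unit at [t]: equality of tagged indices tests the factor and the position at
    once. *)
Definition diag_unit (t : index) : T :=
  [ffun i => \matrix_(p, q) ((p == q) && (tag_index p == t) : boolB)].

Lemma diag_unitE t i p q :
  coord (diag_unit t) i p q = (p == q) && (tag_index p == t).
Proof. by rewrite /coord ffunE mxE. Qed.

Lemma boolB_sum1 (J : finType) (F : J -> boolB) j :
  (forall l, l != j -> F l = 0) -> \sum_l F l = F j.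
Proof. by move=> F0; rewrite (bigD1 j) //= big1 ?addr0. Qed.

Lemma diag_unit_cornerE t u (x : T) i p q :
  coord (diag_unit t * x * diag_unit u) i p q =
  [&& tag_index p == t, coord x i p q & tag_index q == u].
Proof.
rewrite !coordM mxE (boolB_sum1 (j := q)) => [|l lq]; last first.
  by rewrite diag_unitE (negPf lq) mulr0.
rewrite mxE (boolB_sum1 (j := p)) => [|l lp]; last first.
  by rewrite diag_unitE eq_sym (negPf lp) mul0r.
by rewrite !diag_unitE !eqxx; apply/esym/andbA.
Qed.

Lemma diag_unit_corner_neq0 t u (x : T) :
  reflect (exists i (p q : 'I_(n i)),
             [/\ tag_index p = t, tag_index q = u & coord x i p q])
          (diag_unit t * x * diag_unit u != 0).
Proof.
apply: (iffP idP) => [nz|[i [p [q [pt qu xpq]]]]].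
  apply: contrapT => no; case/eqP: nz.
  apply: coord_inj => i; apply/matrixP => p q.
  rewrite diag_unit_cornerE coord0 mxE; apply/negbTE/negP.
  by move=> /and3P[/eqP pt xpq /eqP qu]; apply: no; exists i, p, q.
apply/eqP => /(congr1 (fun x : T => coord x i p q)).
by rewrite diag_unit_cornerE coord0 mxE pt qu xpq !eqxx.
Qed.

Lemma tag_index_inj i (p q : 'I_(n i)) : tag_index p = tag_index q -> p = q.
Proof. by move/eqP; rewrite eq_Tagged => /eqP. Qed.

(** [p] and [r] live in types depending on [i] and [j]; equality of the tags gives [i = j], after
    which they can be identified. *)
Lemma coord_tag_index (x : T) i j (p q : 'I_(n i)) (r s : 'I_(n j)) :
  tag_index p = tag_index r -> tag_index q = tag_index s ->
  coord x i p q = coord x j r s.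
Proof.
move=> pr; have ij : i = j by have := congr1 tag pr.
by case: j / ij r s pr => r s /tag_index_inj<- /tag_index_inj<-.
Qed.

Lemma diag_unit_peirce : peirce_boolean diag_unit.
Proof.
split=> [|t u|t|t u x y|t u v x y|t u x].
- apply: coord_inj => i; apply/matrixP=> p q.
  rewrite (big_morph _ (fun x y : T => coordD x y i) (coord0 _ i)).
  rewrite summxE boolB_sum coord1 mxE.
  have -> : (p == q)%:R = (p == q) :> boolB by case: (p == q).
  apply/existsP/idP => [[t]|pq]; first by rewrite diag_unitE => /andP[].
  by exists (tag_index p); rewrite diag_unitE pq eqxx.
- apply: coord_inj => i; apply/matrixP=> p q.
  rewrite coordM mxE (boolB_sum1 (j := p)) => [|l lp]; last first.
    by rewrite diag_unitE eq_sym (negPf lp) mul0r.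
  have [<-|tu] := eqVneq t u.
    rewrite !diag_unitE eqxx.
    by case: (p == q); case: (tag_index p == t).
  rewrite coord0 mxE !diag_unitE eqxx.
  case: (tag_index p =P t) => [->|_]; last exact: mul0r.
  by rewrite (negPf tu) andbF mulr0.
- case: t => i p; apply/eqP=> /(congr1 (fun x : T => coord x i p p)).
  by rewrite diag_unitE coord0 mxE !eqxx.
- move=> /diag_unit_corner_neq0[i [p [q [pt qu xpq]]]].
  move=> /diag_unit_corner_neq0[i' [p' [q' [pt' qu' ypq]]]].
  apply: coord_inj => j; apply/matrixP=> r s; rewrite !diag_unit_cornerE.
  case: (tag_index r =P t) => //= rt.
  case: (tag_index s =P u) => su; last by rewrite !andbF.
  rewrite -rt in pt pt'; rewrite -su in qu qu'.
  by rewrite -(coord_tag_index x pt qu) xpq -(coord_tag_index y pt' qu') ypq.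
- move=> /diag_unit_corner_neq0[i [p [q [pt qu xpq]]]].
  move=> /diag_unit_corner_neq0[j [r [s [ru sv yrs]]]].
  rewrite -2!(mulrA (diag_unit t)); apply/diag_unit_corner_neq0.
  have ij : i = j by have := congr1 tag (etrans qu (esym ru)).
  case: j / ij r s ru sv yrs => r s ru sv yrs.
  rewrite -ru in qu; have qr := tag_index_inj qu; rewrite -qr in ru yrs.
  (* The shared middle position [q] witnesses both matrix products. *)
  exists i, p, s; split=> //.
  rewrite coordM mxE boolB_sum; apply/existsP; exists q; apply/andP; split=> //.
  rewrite coordM mxE boolB_sum; apply/existsP; exists q; apply/andP; split=> //.
  by rewrite diag_unitE ru !eqxx.
- move=> /diag_unit_corner_neq0[i [p [q [pt qu xpq]]]].
  (* All-ones matrices are nonzero in every corner inside a factor. *)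
  exists [ffun i => const_mx 1].
  apply/diag_unit_corner_neq0; exists i, q, p; split=> //.
  by rewrite /coord ffunE mxE.
Qed.

End MatricesPeirce.

Lemma has_peirce_iso_matrices (S : pzSemiRingType) k (n : 'I_k -> nat) :
    (0 < k)%N -> (forall i, (0 < n i)%N) ->
    semiring_iso S (prod_semiring (fun i : 'I_k => 'M[boolB]_(n i))) ->
  has_peirce S.
Proof.
case: k n => // k n _ n0 [f [g fK gK]].
exists {i : 'I_k.+1 & 'I_(n i)}, (fun t => g (diag_unit t)); split.
  by exists; exists ord0; exists 0%N.
apply: (peirce_iso (f := f)) (can_inj fK) _ _; last by move=> y; exists (g y).
have -> : f \o (fun t => g (diag_unit t)) = @diag_unit _ n.
  by apply: funext => t; apply: gK.
exact: diag_unit_peirce.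
Qed.

Theorem corollary3p5 (S : pzSemiRingType) (S_zsf : zerosumfree S) :
  [<-> right_congruence_semisimple S;
       exists (k : nat) (n : 'I_k -> nat),
         [/\ (0 < k)%N, forall i : 'I_k, (0 < n i)%N
           & semiring_iso S (prod_semiring (fun i : 'I_k => 'M[boolB]_(n i)))];
       left_congruence_semisimple S].
Proof.
(* Right ideals of [S] are left ideals of [S^c], so passing to the converse settles the right-hand
   case. *)
have peirce_right : has_peirce S <-> right_congruence_semisimple S.
  split=> [/has_peirce_converse/has_peirce_left_semisimple //|ss].
  by apply/has_peirce_converse; apply: has_peirce_semisimple ss.
tfae.
- by move=> /peirce_right[I [e [I0 he]]]; apply: peirce_iso_matrices he I0.
- case=> k [n [k0 n0 iso]].
  exact: has_peirce_left_semisimple (has_peirce_iso_matrices k0 n0 iso).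
- by move=> ss; apply/peirce_right/has_peirce_semisimple.
Qed.
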